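(* Let $\mathcal{G}$ be a minor-closed class of graphs. Then $\mathcal{G}$ has bounded layered pathwidth (i.e. there is a constant $c$ with $\operatorname{lpw}(G)\le c$ for all $G\in\mathcal{G}$) if and only if some apex-forest is not in $\mathcal{G}$.
   Context: All graphs are finite and simple. A class $\mathcal{G}$ is minor-closed if every minor of every graph in $\mathcal{G}$ is in $\mathcal{G}$. A path decomposition of $G$ is a sequence $(B_1,\dots,B_n)$ of subsets of $V(G)$ (bags) such that every edge has both endpoints in some bag and, for each vertex $v$, the set $\{i: v\in B_i\}$ is a non-empty interval. A layering of $G$ is a partition $(V_0,\dots,V_t)$ of $V(G)$ such that for every edge $vw$ with $v\in V_i$, $w\in V_j$ we have $|i-j|\le 1$. The layered width of a path decomposition is the minimum $\ell$ such that for some layering, each bag contains at most $\ell$ vertices of each layer. The layered pathwidth $\operatorname{lpw}(G)$ is the minimum layered width of a path decomposition of $G$. A graph $G$ is an apex-forest if $G-v$ is a forest for some vertex $v$. *)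

(* Defs.v *)
From mathcomp Require Import all_boot.
Set Implicit Arguments. Unset Strict Implicit. Unset Printing Implicit Defensive.

Record graph := Graph {
  gn : nat;
  gadj : rel 'I_gn;
  gsym : symmetric gadj;
  girr : irreflexive gadj }.
Arguments gadj : clear implicits.

Definition graph_class := graph -> Prop.

Definition connected_in (G : graph) (S : {set 'I_(gn G)}) : Prop :=
  forall x y, x \in S -> y \in S ->
    connect [rel u v | [&& gadj G u v, u \in S & v \in S]] x y.

Definition is_minor (H G : graph) : Prop :=
  exists B : 'I_(gn H) -> {set 'I_(gn G)},
    [/\ (forall i, B i != set0),
        (forall i j, i != j -> [disjoint B i & B j]),
        (forall i, connected_in (B i)) &
        (forall i j, gadj H i j ->
           exists x y, [/\ x \in B i, y \in B j & gadj G x y])].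

Definition minor_closed (C : graph_class) : Prop :=
  forall G H : graph, C G -> is_minor H G -> C H.

Definition is_path_decomposition (G : graph) (bags : seq {set 'I_(gn G)}) : Prop :=
  (forall u v, gadj G u v ->
     exists k, k < size bags /\ u \in nth set0 bags k /\ v \in nth set0 bags k)
  /\ (forall v, exists i j, i <= j /\ j < size bags /\
        forall k, k < size bags -> (v \in nth set0 bags k) = (i <= k <= j)).

Definition is_layering (G : graph) (L : 'I_(gn G) -> nat) : Prop :=
  forall u v, gadj G u v -> L u <= (L v).+1 /\ L v <= (L u).+1.

Definition layered_width_le (G : graph) (bags : seq {set 'I_(gn G)}) (l : nat) : Prop :=
  exists L, is_layering L /\
    forall B i, B \in bags -> #|[set v in B | L v == i]| <= l.

Definition lpw_le (G : graph) (l : nat) : Prop :=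
  exists bags : seq {set 'I_(gn G)}, is_path_decomposition bags /\ layered_width_le bags l.

Definition bounded_lpw (C : graph_class) : Prop :=
  exists c, forall G, C G -> lpw_le G c.

Definition forest_minus (G : graph) (v : 'I_(gn G)) : Prop :=
  forall c : seq 'I_(gn G), 3 <= size c -> uniq c -> v \notin c -> ~~ cycle (gadj G) c.

Definition apex_forest (G : graph) : Prop :=
  exists v : 'I_(gn G), forest_minus v.

(* Main.v *)
Require Import Defs.
From mathcomp Require Import all_boot zify.
Set Implicit Arguments. Unset Strict Implicit. Unset Printing Implicit Defensive.

(** Bounded layered pathwidth excludes an apex-forest because a dominating vertex
    confines any layering to three layers, while trees have unbounded pathwidth.

    Conversely, let [K] be a vertex set whose neighbours outside [K] lie in a
    connected set [O], and let [R] be the set of vertices of [K] adjacent to [O].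
    Contracting [O] to the apex, an excluded apex-forest forbids in [K] a model of
    a forest all of whose branch sets meet [R].  A rooted version of Diestel's
    proof of the pathwidth theorem then yields a path decomposition of [K] with
    bounded adhesion and boundedly many vertices of [R] in each bag.  The vertices
    of [R] and of the adhesions form the first layer [M]; the neighbours of each
    component [C] of [K :\: M] lie in one bag.  Once [M] is chosen so
    that the neighbours of [C] lie in one connected set avoiding [C], recursion
    applies to [C], with the next layer.  No width accumulates, since [C] sees
    only the bag of [M] it is attached to. *)

(** * Connectivity inside vertex sets *)

Definition restr (T : finType) (e : rel T) (S : {set T}) : rel T :=
  [rel u v | [&& e u v, u \in S & v \in S]].

Definition conn (T : finType) (e : rel T) (S : {set T}) :=
  forall x y, x \in S -> y \in S -> connect (restr e S) x y.

Definition component (T : finType) (e : rel T) (S : {set T}) x :=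
  [set y | connect (restr e S) x y].

Section Connectivity.
Variables (T : finType).
Implicit Types (e : rel T) (S A B : {set T}).

Lemma restr_sym e S : symmetric e -> symmetric (restr e S).
Proof. by move=> se u v; rewrite /restr /= se; congr (_ && _); rewrite andbC. Qed.

Lemma sub_conn e e' S : subrel e e' -> conn e S -> conn e' S.
Proof.
move=> ee' cS x y xS yS; apply: connect_sub (cS x y xS yS) => u v.
by case/and3P=> /ee' euv uS vS; apply: connect1; rewrite /restr /= euv uS vS.
Qed.

Lemma conn1 e x : conn e [set x].
Proof. by move=> u v /set1P-> /set1P->; apply: connect0. Qed.

Lemma conn0 e : conn e set0.
Proof. by move=> u v; rewrite inE. Qed.

Lemma connect_widen e A B : A \subset B ->
  subrel (connect (restr e A)) (connect (restr e B)).
Proof.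
move=> AB; apply: connect_sub => u v /and3P[euv uA vA].
by apply: connect1; rewrite /restr /= euv !(subsetP AB).
Qed.

Lemma connU e A B x y : symmetric e -> conn e A -> conn e B ->
  x \in A -> y \in B -> (x == y) || e x y -> conn e (A :|: B).
Proof.
move=> se cA cB xA yB exy.
have sym := sym_connect_sym (restr_sym (A :|: B) se).
have xy : connect (restr e (A :|: B)) x y.
  case/orP: exy => [/eqP-> | exy]; first exact: connect0.
  by apply: connect1; rewrite /restr /= exy !inE xA yB orbT.
have toy z : z \in A :|: B -> connect (restr e (A :|: B)) z y.
  case/setUP=> [zA | zB].
    by apply: connect_trans xy; apply: connect_widen (cA _ _ zA xA); apply: subsetUl.
  by apply: connect_widen (cB _ _ zB yB); apply: subsetUr.
by move=> u v /toy uy /toy; rewrite sym; apply: connect_trans.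
Qed.

Lemma connect_closed e S A x y :
  (forall u v, u \in S -> v \in S -> e u v -> u \in A -> v \in A) ->
  connect (restr e S) x y -> x \in A -> y \in A.
Proof.
move=> clA /connectP[p]; elim: p x => [|z p IH] x /=; first by move=> _ ->.
by case/andP=> /and3P[exz xS zS] /IH{}IH /IH{}IH /(clA _ _ xS zS exz).
Qed.

Lemma conn_closed e S A x :
  (forall u v, u \in S -> v \in S -> e u v -> u \in A -> v \in A) ->
  conn e S -> x \in S -> x \in A -> S \subset A.
Proof.
move=> clA cS xS xA; apply/subsetP => y yS.
exact: connect_closed clA (cS _ _ xS yS) xA.
Qed.

Lemma component_refl e S x : x \in component e S x.
Proof. by rewrite inE connect0. Qed.

Lemma component_sub e S x : x \in S -> component e S x \subset S.
Proof.
move=> xS; apply/subsetP=> y; rewrite inE => xy.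
by apply: connect_closed xy xS => u v _ vS.
Qed.

Lemma component_closed e S x u v : x \in S -> u \in component e S x -> v \in S -> e u v ->
  v \in component e S x.
Proof.
move=> xS uC vS euv; have uS := subsetP (component_sub e xS) _ uC.
move: uC; rewrite !inE => xu; apply: connect_trans xu _.
by apply: connect1; rewrite /restr /= euv uS vS.
Qed.

Lemma conn_component e S x : symmetric e -> x \in S -> conn e (component e S x).
Proof.
move=> se xS.
have sym := sym_connect_sym (restr_sym (component e S x) se).
have fromx y : y \in component e S x -> connect (restr e (component e S x)) x y.
  rewrite inE => xy.
  (* The walk in [S] is replayed inside the component: reachability there is preserved by each
     step. *)
  suff : y \in [set z in component e S x | connect (restr e (component e S x)) x z].
    by rewrite !inE => /andP[].
  apply: (connect_closed _ xy); last by rewrite !inE !connect0.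
  move=> u v uS vS euv; rewrite inE => /andP[uC xu].
  have vC := component_closed xS uC vS euv.
  rewrite inE vC; apply: connect_trans xu _.
  by apply: connect1; rewrite /restr /= euv uC vC.
by move=> y z /fromx; rewrite sym => yx /fromx; apply: connect_trans.
Qed.

Lemma component_max e S A x : conn e A -> x \in A -> A \subset S -> A \subset component e S x.
Proof.
move=> cA xA AS; apply/subsetP=> y yA; rewrite inE.
exact: connect_widen AS _ _ (cA _ _ xA yA).
Qed.

End Connectivity.

(* With [Q] nonempty this is the boundary in the graph with one extra outer
   vertex adjacent to all of [Q]. *)
Definition bd (T : finType) (e : rel T) (Q X : {set T}) :=
  [set x in X | (x \in Q) || [exists y, e x y && (y \notin X)]].

Lemma bdP (T : finType) (e : rel T) (Q X : {set T}) x :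
  reflect (x \in X /\ (x \in Q \/ exists2 y, e x y & y \notin X)) (x \in bd e Q X).
Proof.
rewrite inE; apply: (iffP andP) => [[xX /orP[xQ|/existsP[y /andP[? ?]]]]|[xX [xQ|[y exy yX]]]].
- by split=> //; left.
- by split=> //; right; exists y.
- by rewrite xX xQ.
by split=> //; apply/orP; right; apply/existsP; exists y; rewrite exy.
Qed.

Lemma bd_sub (T : finType) (e : rel T) (Q X : {set T}) : bd e Q X \subset X.
Proof. by apply/subsetP=> x; rewrite inE => /andP[]. Qed.

(** Adding [y] leaves fewer vertices outside, so no old vertex can join the boundary. *)
Lemma bd_setU1 (T : finType) (e : rel T) (Q X : {set T}) y :
  bd e Q (y |: X) \subset y |: bd e Q X.
Proof.
apply/subsetP=> x /bdP[/setU1P[->|xX] h]; rewrite !in_setU1 ?eqxx //.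
apply/orP; right; apply/bdP; split=> //; case: h => [|[z exz]]; first by left.
by rewrite !inE negb_or => /andP[_ zX]; right; exists z.
Qed.

Lemma disjointsU1 (T : finType) (A B : {set T}) x :
  [disjoint x |: A & B] = (x \notin B) && [disjoint A & B].
Proof. by rewrite -setI_eq0 setIUl setU_eq0 !setI_eq0 disjoints1. Qed.

(** * Menger's theorem for nested sets *)

Section Linkage.
Variable T : finType.
Implicit Types (e : rel T) (Q A B Y : {set T}).

(** Disjoint connected sets replace the disjoint paths of Menger's theorem. Each meets [A] only in
    its start, so it can be glued to branch sets inside [A]. *)
Definition linkage e Q A B (P : T -> {set T}) :=
  (forall a, a \in bd e Q A ->
    [/\ a \in P a, conn e (P a), P a \subset a |: (B :\: A) &
        exists2 b, b \in P a & b \in bd e Q B])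
  /\ {in bd e Q A &, forall a b, a != b -> [disjoint P a & P b]}.

(** The first sets stay in [Y] and the second ones meet [Y] only in their starts, so the two
    families can collide only at the gluing vertices [f a]. *)
Lemma linkage_comp e Q A Y B P1 P2 : symmetric e -> A \subset Y -> Y \subset B ->
  linkage e Q A Y P1 -> linkage e Q Y B P2 -> exists P, linkage e Q A B P.
Proof.
move=> se AY YB [h1 d1] [h2 d2].
pose f a := odflt a [pick b in P1 a :&: bd e Q Y].
have fP a : a \in bd e Q A -> f a \in P1 a /\ f a \in bd e Q Y.
  case/h1=> _ _ _ [b b1 b2]; rewrite /f; case: pickP => [c /setIP[]|/(_ b)] //=.
  by rewrite inE b1 b2.
have P1Y a : a \in bd e Q A -> P1 a \subset Y.
  move=> aA; have [_ _ s _] := h1 a aA; apply: subset_trans s _.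
  by rewrite subUset subsetDl sub1set (subsetP AY) // (subsetP (bd_sub _ _ _) _ aA).
exists (fun a => P1 a :|: P2 (f a)); split.
  move=> a aA; have [a1 c1 s1 _] := h1 a aA; have [f1 f2] := fP a aA.
  have [a2 c2 s2 [b b1 b2]] := h2 _ f2; split.
  - by rewrite inE a1.
  - by apply: (connU se c1 c2 f1 a2); rewrite eqxx.
  - rewrite subUset; apply/andP; split.
      by apply: subset_trans s1 _; apply: setUS; apply: setSD.
    apply/subsetP=> z /(subsetP s2) /setU1P[-> | /setDP[zB zY]].
      by have:= subsetP s1 _ f1; rewrite !inE => /orP[->//|/andP[-> /(subsetP YB) ->]]; rewrite orbT.
    by rewrite !inE zB (contra (subsetP AY z)) // orbT.
  - by exists b => //; rewrite in_setU b1 orbT.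
have dis12 a b : a \in bd e Q A -> b \in bd e Q A -> a != b -> [disjoint P1 a & P2 (f b)].
  move=> aA bA ab; have [fa fy] := fP b bA; have [_ _ s2 _] := h2 _ fy.
  apply/pred0P=> z /=; apply/negP=> /andP[z1 /(subsetP s2)].
  rewrite !inE (subsetP (P1Y _ aA) _ z1) /= orbF => /eqP zf.
  by have /pred0P/(_ z) := d1 _ _ aA bA ab; rewrite /= z1 zf fa.
move=> a b aA bA ab; have [fa fya] := fP a aA; have [fb fyb] := fP b bA.
have fab : f a != f b.
  apply: contraTneq (d1 _ _ aA bA ab) => fe.
  by apply/pred0Pn; exists (f a); rewrite /= fa fe fb.
rewrite -setI_eq0 setIUl !setIUr !setU_eq0 !setI_eq0 d1 //= dis12 //=.
by rewrite disjoint_sym dis12 1?eq_sym // d2.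
Qed.

(** Induction on [#|B :\: A|], over all [e] because deleting a vertex changes [e]. An intermediate
    [Y] whose boundary is no larger than that of [A] splits the problem, and the two linkages
    compose. *)
Lemma linkage_exists e Q A B : symmetric e -> A \subset B ->
  (forall Y, A \subset Y -> Y \subset B -> #|bd e Q A| <= #|bd e Q Y|) ->
  exists P, linkage e Q A B P.
Proof.
have [m] := ubnP #|B :\: A|; elim: m => // m IH in e A B *.
rewrite ltnS => lem se AB hm.
have [/subsetP sub|/subsetPn[a aA aB]] := boolP (bd e Q A \subset bd e Q B).
  exists (fun a => [set a]); split=> [a aA|a b _ _ ab].
    split; [by rewrite inE | exact: conn1 | by rewrite sub1set !inE eqxx |].
    by exists a; [rewrite inE | apply: sub].
  by rewrite disjoints1 inE.
have aA' : a \in A by move/bdP: aA => [].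
have aBB : a \in B := subsetP AB _ aA'.
(* As [a] lies in [B] but not in its boundary, it is outside [Q] and all its neighbours are in
   [B]. *)
have aQ : a \notin Q by apply: contra aB => aQ; apply/bdP; split; [|left].
have [y eay yA] : exists2 y, e a y & y \notin A.
  by move/bdP: (aA) => [_ [/(negP aQ)|]].
have yB : y \in B by apply: contraR aB => yB; apply/bdP; split=> //; right; exists y.
have ya : y != a by apply: contraNneq yA => ->.
have [/existsP[Y /and3P[AY YB YA]]|noY] :=
    boolP [exists Y : {set T}, [&& A \proper Y, Y \proper B & #|bd e Q Y| <= #|bd e Q A|]].
  have [AsY YsB] := (proper_sub AY, proper_sub YB).
  have [||||P1 l1] := IH e A Y => //.
  - apply: leq_trans lem; apply: proper_card; rewrite properE setSD //=.
    have [_ [z zB zY]] := properP YB; apply/subsetPn; exists z; rewrite !inE ?zB ?(negPf zY) ?andbF //.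
    by rewrite (contra (subsetP AsY z)).
  - by move=> Z AZ ZY; apply: hm => //; apply: subset_trans YsB.
  have [||||P2 l2] := IH e Y B => //.
  - apply: leq_trans lem; apply: proper_card; rewrite properE setDS //=.
    have [_ [z zY zA]] := properP AY; apply/subsetPn; exists z; rewrite !inE ?zA ?zY ?(subsetP YsB) //.
  - by move=> Z YZ ZB; apply: leq_trans YA _; apply: hm => //; apply: subset_trans YZ.
  exact: linkage_comp l1 l2.
(* No intermediate set is tight, so deleting [a] keeps every boundary between
   [y |: A] and [B] large, and [a] can be re-attached to the path starting at [y]. *)
pose e' := [rel u v | [&& e u v, u != a & v != a]].
have se' : symmetric e' by move=> u v; rewrite /= se; congr (_ && _); rewrite andbC.
pose A1 := y |: A.
have A1B : A1 \subset B by rewrite subUset sub1set yB.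
have AA1 : A \proper A1.
  by rewrite properE subsetUr /=; apply/subsetPn; exists y; rewrite ?inE ?eqxx.
have sub1 : bd e' Q A1 \subset y |: (bd e Q A :\ a).
  apply/subsetP=> x xb; have : x \in y |: bd e Q A.
    apply: subsetP (bd_setU1 _ _ _ _) _ _; move/bdP: xb => [xA1 h].
    apply/bdP; split=> //; case: h => [|[z /and3P[exz _ _] zA]]; [by left|by right; exists z].
  have xa : x != a.
    case/bdP: xb => _ [xQ|[z /and3P[]]] //.
    by apply: contraNneq aQ => <-.
  by rewrite !inE xa.
have card1 : #|y |: (bd e Q A :\ a)| = #|bd e Q A|.
  rewrite cardsU1 (cardsD1 a (bd e Q A)) aA !inE negb_and negbK.
  by rewrite (negPf yA) /= orbT.
have big Y : A1 \subset Y -> Y \subset B -> #|bd e Q A| <= #|bd e' Q Y|.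
  (* For [Y = B] nothing is lost, as [a] is not in the boundary of [B]; below [B] the absence of
     tight sets gives a surplus of one that pays for [a]. *)
  move=> A1Y YB; have [eYB|nYB] := eqVneq Y B.
    apply: leq_trans (hm B AB (subxx _)) _; rewrite -eYB in aB *; apply: subset_leq_card.
    apply/subsetP=> x xb; have xa : x != a by apply: contraNneq aB => <-.
    move/bdP: xb => [xY h]; apply/bdP; split=> //; case: h => [|[z exz zY]]; [by left|right].
    exists z => //=; rewrite exz xa; apply: contraNneq zY => ->.
    by rewrite eYB.
  have : #|bd e Q A| < #|bd e Q Y|.
    rewrite ltnNge; apply: contra noY => le; apply/existsP; exists Y.
    by rewrite le (proper_sub_trans AA1 A1Y) properEneq nYB YB.
  rewrite (cardsD1 a (bd e Q Y)) => lt.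
  have {}lt : #|bd e Q A| <= #|bd e Q Y :\ a| by rewrite -ltnS; apply: leq_trans lt _; rewrite -add1n leq_add2r leq_b1.
  apply: leq_trans lt _; apply: subset_leq_card; apply/subsetP=> x.
  rewrite in_setD1 => /andP[xa /bdP[xY h]]; apply/bdP; split=> //.
  case: h => [|[z exz zY]]; [by left|right].
  exists z => //=; rewrite exz xa; apply: contraNneq zY => ->.
  by rewrite (subsetP A1Y) // inE aA' orbT.
have eq1 : bd e' Q A1 = y |: (bd e Q A :\ a).
  by apply/eqP; rewrite eqEcard sub1 card1 big.
have [||||P' [h1 d1]] := IH e' A1 B => //.
- apply: leq_trans lem; apply: proper_card; rewrite properE setDS ?(proper_sub AA1) //=.
  by apply/subsetPn; exists y; rewrite !inE ?eqxx ?yA ?yB.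
- by move=> Y A1Y YB; rewrite eq1 card1 big.
have yb : y \in bd e' Q A1 by rewrite eq1 !inE eqxx.
have e'e : subrel e' e by move=> u v /and3P[].
have ub u : u \in bd e Q A -> u != a -> u \in bd e' Q A1.
  by move=> uA ua; rewrite eq1 in_setU1 in_setD1 ua uA orbT.
have BA1 : B :\: A1 \subset B :\: A by rewrite setDS // proper_sub.
have aP' u : u \in bd e' Q A1 -> a \notin P' u.
  move=> ub1; have [_ _ s _] := h1 u ub1; apply/negP=> /(subsetP s).
  rewrite in_setU1 in_setD in_setU1 aA' orbT /= orbF => /eqP au; move: ub1.
  by rewrite eq1 -au in_setU1 in_setD1 eqxx /= orbF eq_sym (negPf ya).
have bdB x : x \in bd e' Q B -> x \in bd e Q B.
  case/bdP=> xB h; apply/bdP; split=> //; case: h => [|[z /and3P[exz _ _] zA]]; [by left|by right; exists z].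
exists (fun u => if u == a then a |: P' y else P' u); split.
  move=> u uA; have [->|ua] := eqVneq u a.
    have [y1 c s [b b1 b2]] := h1 y yb; split.
    - by rewrite !inE eqxx.
    - apply: (connU se (@conn1 _ e a) (sub_conn e'e c) _ y1); first by rewrite inE.
      by rewrite eay orbT.
    - by apply: setUS; apply: subset_trans s _; rewrite subUset BA1 sub1set !inE yA yB.
    - by exists b; [rewrite in_setU1 b1 orbT | apply: bdB].
  have [y1 c s [b b1 b2]] := h1 u (ub u uA ua); split => //.
  - exact: sub_conn c.
  - by apply: subset_trans s _; apply: setUS.
  - by exists b; last apply: bdB.
have disy u : u \in bd e Q A -> u != a -> [disjoint a |: P' y & P' u].
  move=> uA ua; rewrite disjointsU1 aP' ?ub //= d1 // ?ub //.
  by apply: contraNneq yA => ->; move/bdP: uA => [].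
move=> u v uA vA uv /=; have [ua|ua] := eqVneq u a; have [va|va] := eqVneq v a.
- by rewrite ua va eqxx in uv.
- exact: disy.
- by rewrite disjoint_sym; apply: disy.
- by apply: d1; rewrite ?ub.
Qed.

End Linkage.

(** * Submodularity of the boundary *)

Section BdSubmodular.
Variables (T : finType) (e : rel T).
Local Notation bd0 := (bd e set0).

Lemma bd0P (X : {set T}) x :
  reflect (x \in X /\ exists2 y, e x y & y \notin X) (x \in bd0 X).
Proof.
apply: (iffP (bdP _ _ _ _)) => [[xX [|//]]|[xX h]]; first by rewrite inE.
by split=> //; right.
Qed.

Lemma bd0_set0 : bd0 set0 = set0.
Proof. by apply/eqP; rewrite -subset0 bd_sub. Qed.

Lemma bd0_setT : bd0 setT = set0.
Proof. by apply/setP=> x; rewrite in_set0; apply/bd0P => -[_ [y _]]; rewrite inE. Qed.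

(** By [cardsUI] both sums become a union plus an intersection, and each on the left is included in
    its counterpart on the right. *)
Lemma bd0_submod X Y :
  #|bd0 (X :&: Y)| + #|bd0 (X :|: Y)| <= #|bd0 X| + #|bd0 Y|.
Proof.
rewrite -cardsUI -[leqRHS]cardsUI leq_add // subset_leq_card //; apply/subsetP=> x.
  case/setUP=> /bd0P[xI [y exy]]; rewrite !inE.
    move: xI; rewrite inE => /andP[xX xY]; rewrite negb_and xX xY => /orP[] ny.
      by apply/orP; left; apply/existsP; exists y; rewrite exy.
    by apply/orP; right; apply/existsP; exists y; rewrite exy.
  move: xI; rewrite inE negb_or => /orP[] xX /andP[yX yY]; rewrite xX /=.
    by apply/orP; left; apply/existsP; exists y; rewrite exy.
  by apply/orP; right; apply/existsP; exists y; rewrite exy.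
case/setIP=> /bd0P[/setIP[xX xY] _] /bd0P[_ [y exy]].
rewrite inE negb_or => /andP[yX yY]; apply/setIP.
by split; apply/bd0P; split=> //; exists y.
Qed.

End BdSubmodular.

(* For the edge relation of a graph this says that [U0] induces a forest. *)
Definition thin (I : finType) (h : rel I) (U0 : {set I}) :=
  forall U : {set I}, U \subset U0 -> U != set0 ->
  exists2 u, u \in U & {in U &, forall a b, h u a -> h u b -> a = b}.

(** * Rooted forest minors *)

Section RootedForest.
Variables (T : finType) (e : rel T) (R : {set T}) (n : nat).
Hypothesis se : symmetric e.
Implicit Types X Y Z : {set T}.
Local Notation bd0 := (bd e set0).

(* A chain from [set0] to [setT] is a path decomposition of small adhesion with
   few vertices of [R] in each bag; the bags themselves may be large. *)
Definition step : rel {set T} :=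
  [rel X Y : {set T} | [&& X \subset Y, #|bd0 Y| <= n & #|R :&: (Y :\: X)| <= n]].

Definition good : pred {set T} := connect step set0.

Lemma good_step X Y : good X -> X \subset Y -> #|bd0 Y| <= n ->
  #|R :&: (Y :\: X)| <= n -> good Y.
Proof.
move=> gX XY bY rY; apply: connect_trans gX _; apply: connect1.
by rewrite /step /= XY bY.
Qed.

Lemma good_setU1 X y : good X -> #|bd0 X| < n -> good (y |: X).
Proof.
move=> gX bX; apply: (good_step gX); first exact: subsetUr.
  apply: leq_trans (subset_leq_card (bd_setU1 _ _ _ _)) _.
  by rewrite cardsU1; apply: leq_trans bX; rewrite -add1n leq_add2r leq_b1.
apply: leq_trans (leq_ltn_trans (leq0n _) bX).
rewrite -(cards1 y); apply: subset_leq_card; apply/subsetP=> z.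
by rewrite !inE => /and3P[_ /negPf->]; rewrite orbF.
Qed.

(* Submodularity: as [Y] has the least boundary between [Y] and [X], cutting a
   chain for [X] down to [Y] does not increase the boundaries. *)
Lemma good_cap X Y : good X -> Y \subset X ->
  (forall Z, Y \subset Z -> Z \subset X -> #|bd0 Y| <= #|bd0 Z|) -> good Y.
Proof.
move=> gX YX mY; suff main Z : good Z -> Z \subset X -> good (Y :&: Z).
  by rewrite -(setIidPl YX); apply: main.
case/connectP=> s; elim/last_ind: s Z => [|s Z' IH] Z /=.
  by move=> _ -> _; rewrite setI0; apply: connect0.
rewrite rcons_path last_rcons => /andP[ps /and3P[sZ bZ rZ]] -> ZX.
apply: (good_step (IH _ ps erefl (subset_trans sZ ZX))).
- exact: setIS.
- apply: leq_trans bZ; rewrite -(leq_add2r #|bd0 Y|).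
  rewrite [leqRHS]addnC; apply: leq_trans (bd0_submod _ _ _); rewrite leq_add2l.
  by apply: mY; rewrite ?subsetUl // subUset YX.
- apply: leq_trans rZ; apply: subset_leq_card; apply/subsetP=> z.
  rewrite !inE negb_and => /and3P[-> /orP[/negPf->|->] /andP[] //] _ ->.
Qed.

(** Every good proper superset of such an [X] has more than [i] boundary vertices, which excludes
    small separators later. *)
Definition maxgood i X := maxset (fun X => good X && (#|bd0 X| <= i)) X.

(** A set between [y |: X] and [X'] with boundary at most [i] would contradict the maximality of
    [X]; Menger's theorem therefore links the two boundaries, both of size [i.+1]. *)
Lemma grow i X y : maxgood i X -> #|bd0 X| = i -> i < n -> y \notin X ->
  exists X' P, [/\ maxgood i.+1 X', #|bd0 X'| = i.+1, y |: X \subset X',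
    bd0 (y |: X) = y |: bd0 X & linkage e set0 (y |: X) X' P].
Proof.
move=> mX cX lt yX; have [/andP[gX _] maxX] := maxsetP mX.
have gy : good (y |: X) by apply: good_setU1; rewrite ?cX.
have yb : y \notin bd0 X by apply: contra yX => /(subsetP (bd_sub _ _ _)).
have cy : #|y |: bd0 X| = i.+1 by rewrite cardsU1 yb cX.
have by1 : #|bd0 (y |: X)| <= i.+1.
  by rewrite -cy subset_leq_card // bd_setU1.
have [X' mX' sX'] := @maxset_exists _ (fun X => good X && (#|bd0 X| <= i.+1)) (y |: X) (introT andP (conj gy by1)).
have [/andP[gX' bX'] _] := maxsetP mX'.
have big Y : y |: X \subset Y -> Y \subset X' -> i < #|bd0 Y|.
  (* [Y] itself may fail to be good, but an intermediate set of least boundary is good by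
     [good_cap]. *)
  move=> yY YX'; pose Pr Z := (y |: X \subset Z) && (Z \subset X').
  have PY : Pr Y by rewrite /Pr yY.
  case: (arg_minnP (fun Z => #|bd0 Z|) PY) => Z /andP[yZ ZX'] minZ.
  apply: leq_trans (minZ _ PY); rewrite ltnNge; apply/negP=> bZ.
  have gZ : good Z.
    apply: (good_cap gX' ZX') => W ZW WX'; apply: minZ.
    by rewrite /Pr WX' (subset_trans yZ).
  have ZX : Z = X.
    by apply: maxX; rewrite ?gZ //; apply: subset_trans yZ; apply: subsetUr.
  by case/negP: yX; rewrite -ZX (subsetP yZ) ?setU11.
have by2 : bd0 (y |: X) = y |: bd0 X.
  by apply/eqP; rewrite eqEcard bd_setU1 cy big.
have [|P lP] := @linkage_exists _ e set0 (y |: X) X' se sX'.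
  by move=> Y yY YX'; rewrite by2 cy big.
exists X', P; split=> //; apply/eqP; rewrite eqn_leq bX' big //.
Qed.

Section Model.
Variables (I : finType) (h : rel I).
Hypothesis hs : symmetric h.
Hypothesis hirr : irreflexive h.

Definition model (U : {set I}) (V : I -> {set T}) :=
  [/\ {in U, forall u, conn e (V u)},
      {in U &, forall u v, u != v -> [disjoint V u & V v]} &
      {in U &, forall u v, h u v -> exists x y, [/\ x \in V u, y \in V v & e x y]}].

(** Old branch sets lie in [X], and an added set meets [X] at most in its own representative [x u],
    so disjointness survives. *)
Lemma model_extend (U : {set I}) V (X Z : {set T}) (x : I -> T) (P : T -> {set T}) :
  model U V -> {in U, forall u, [/\ V u \subset X, x u \in V u & x u \in Z]} ->
  {in Z, forall z, [/\ z \in P z, conn e (P z) & P z :&: X \subset [set z]]} ->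
  {in Z &, forall y z, y != z -> [disjoint P y & P z]} ->
  model U (fun u => V u :|: P (x u)).
Proof.
move=> [cV dV eV] xV hP dP.
have xinj u v : u \in U -> v \in U -> u != v -> x u \notin V v.
  by move=> uU vU uv; rewrite (disjointFr (dV _ _ uU vU uv)) //; case: (xV u uU).
have VP a b : a \in U -> b \in U -> a != b -> [disjoint V a & P (x b)].
  move=> aU bU ab; apply/pred0P=> z /=; apply/negP=> /andP[za zP].
  have [[aX _ _] [_ _ bZ]] := (xV a aU, xV b bU); have [_ _ s] := hP _ bZ.
  have /set1P zx : z \in [set x b] by rewrite (subsetP s) // inE zP (subsetP aX).
  by move: za; rewrite zx; apply/negP; apply: xinj => //; rewrite eq_sym.
split.
- move=> u uU; have [_ xu xZ] := xV u uU; have [xP cP _] := hP _ xZ.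
  by apply: (connU se (cV _ uU) cP xu xP); rewrite eqxx.
- move=> u v uU vU uv; have [[_ xu uZ] [_ _ vZ]] := (xV u uU, xV v vU).
  have xuv : x u != x v by apply: contraTneq xu => ->; apply: xinj; rewrite // eq_sym.
  rewrite -setI_eq0 setIUl !setIUr !setU_eq0 !setI_eq0 dV // VP //= dP //.
  by rewrite andbT disjoint_sym VP // eq_sym.
move=> u v uU vU huv; have [a [b [ha hb hab]]] := eV u v uU vU huv.
by exists a, b; rewrite !in_setU ha hb.
Qed.

(** Each branch set keeps a representative on the boundary of [X]. A vertex [u0] with at most one
    neighbour in [U] is added last: its branch set starts at a vertex [y] outside [X], and the
    linkage from [grow] carries all representatives to the new boundary. *)
Lemma forest_model (U0 U : {set I}) : thin h U0 -> U \subset U0 -> #|U0| <= n -> ~~ good setT ->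
  exists X V x, [/\ maxgood #|U| X, #|bd0 X| = #|U|, model U V &
    {in U, forall u, [/\ V u \subset X, x u \in V u & x u \in bd0 X]}].
Proof.
move=> thinU0 + len ng; have [m] := ubnP #|U|; elim: m => // m IH in U *.
rewrite ltnS => lem UU0; have [->|Un0] := eqVneq U set0.
  have P0 : good set0 && (#|bd0 set0| <= 0) by rewrite bd0_set0 cards0 /good connect0.
  have [X mX _] := @maxset_exists _ (fun X => good X && (#|bd0 X| <= 0)) set0 P0.
  have [/andP[_]] := maxsetP mX; rewrite leqn0 => /eqP bX _.
  (* [setT] is not good, so [X] misses a vertex; it serves as the value of the vacuous
     representative map. *)
  have [t _] : exists t : T, true.
    have /subsetPn[t _ _] : ~~ (setT \subset X).
      rewrite subTset; apply: contraNneq ng => XT.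
      by rewrite -XT; case/maxsetP: mX => /andP[].
    by exists t.
  exists X, (fun=> set0), (fun=> t).
  split; rewrite ?cards0 //; last by move=> u; rewrite inE.
  by split=> [u|u v|u v]; rewrite inE.
have [u0 u0U thin0] := thinU0 U UU0 Un0.
pose U' := U :\ u0.
have cU : #|U| = #|U'|.+1 by rewrite (cardsD1 u0 U) u0U.
have U'U : U' \subset U by apply: subD1set.
have [||X [V [x [mX cX [cV dV eV] xV]]]] := IH U'; first by rewrite -cU.
  exact: subset_trans UU0.
have U'P u : (u \in U') = (u != u0) && (u \in U) by rewrite in_setD1.
(* The representative of the only possible neighbour of [u0] has a neighbour outside [X]; if [u0]
   has no neighbour in [U'], any vertex outside [X] will do. *)
have [y yX yV] : exists2 y, y \notin X & forall j, j \in U' -> h u0 j ->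
    e (x j) y.
  have [j /andP[jU hj]|nj] := pickP (fun j => (j \in U') && h u0 j).
    have [_ _ /bd0P[_ [y ey yX]]] := xV j jU; exists y => // j' jU' hj'.
    by rewrite (thin0 j' j) ?(subsetP U'U).
  have /subsetPn[t _ tX] : ~~ (setT \subset X).
    rewrite subTset; apply: contraNneq ng => XT.
    by rewrite -XT; case/maxsetP: mX => /andP[].
  by exists t => // j jU hj; move: (nj j); rewrite jU hj.
have lt : #|U'| < n by rewrite -cU; apply: leq_trans len; apply: subset_leq_card.
have [X' [P [mX' cX' sX' by2 [hP dP]]]] := grow mX cX lt yX.
have XX' : X \subset X' by apply: subset_trans sX'; apply: subsetUr.
have PcapX z : z \in bd0 (y |: X) -> P z :&: X \subset [set z].
  move=> zb; have [_ _ s _] := hP z zb; apply/subsetP=> u /setIP[/(subsetP s)].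
  by rewrite !inE negb_or => /orP[|/andP[/andP[_ /negPf->]]].
have ybd : y \in bd0 (y |: X) by rewrite by2 !inE eqxx.
have xbd u : u \in U' -> x u \in bd0 (y |: X).
  by move=> /xV[_ _ xb]; rewrite by2 in_setU1 xb orbT.
have [cE dE eE] : model U' (fun u => V u :|: P (x u)).
  apply: (model_extend (X := X) (Z := bd0 (y |: X)) (And3 cV dV eV)) => // [u uU|z zb].
    by have [? ? _] := xV u uU; split=> //; apply: xbd.
  by have [? ? _ _] := hP z zb; split=> //; apply: PcapX.
pose V' u := if u == u0 then P y else V u :|: P (x u).
have V'X u : u \in U -> V' u \subset X'.
  have PX z : z \in bd0 (y |: X) -> P z \subset X'.
    move=> zb; have [_ _ s _] := hP z zb; apply: subset_trans s _.
    rewrite subUset subsetDl sub1set andbT; apply: (subsetP sX').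
    exact: (subsetP (bd_sub _ _ _) _ zb).
  rewrite /V'; case: eqVneq => [_ _|uu uU]; first exact: PX.
  have uU' : u \in U' by rewrite U'P uu.
  by rewrite subUset PX ?xbd // andbT; case: (xV u uU') => s _ _; apply: subset_trans XX'.
have V'b u : u \in U -> exists z, z \in V' u /\ z \in bd0 X'.
  rewrite /V'; case: eqVneq => [_ _|uu uU].
    by have [_ _ _ [z z1 z2]] := hP y ybd; exists z.
  have uU' : u \in U' by rewrite U'P uu.
  by have [_ _ _ [z z1 z2]] := hP _ (xbd u uU'); exists z; rewrite in_setU z1 orbT.
have [x' x'P] : exists x', forall u, u \in U -> x' u \in V' u /\ x' u \in bd0 X'.
  apply: (@fin_all_exists _ _ (fun u z => u \in U -> z \in V' u /\ z \in bd0 X')) => u.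
  by have [/V'b[z zP]|_] := boolP (u \in U); [exists z | exists y].
have disy u : u \in U' -> [disjoint V u :|: P (x u) & P y].
  move=> uU; have [VX xu _] := xV u uU; have xX := subsetP VX _ xu.
  rewrite -setI_eq0 setIUl setU_eq0 !setI_eq0 dP ?xbd ?ybd ?andbT //; last first.
    by apply: contraNneq yX => <-.
  apply/pred0P=> z /=; apply/negP=> /andP[/(subsetP VX) zX zP].
  have /set1P zy : z \in [set y] by rewrite (subsetP (PcapX y ybd)) // inE zP.
  by move: yX; rewrite -zy zX.
exists X', V', x'; split.
- by rewrite cU.
- by rewrite cU.
- split.
  + move=> u uU; rewrite /V'; case: eqVneq => [_|uu]; first by case: (hP y ybd).
    by apply: cE; rewrite U'P uu.
  + move=> u v uU vU uv; rewrite /V'; have [eu|nu] := eqVneq u u0; have [ev|nv] := eqVneq v u0.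
    * by rewrite eu ev eqxx in uv.
    * by rewrite disjoint_sym disy // U'P nv.
    * by rewrite disy // U'P nu.
    by apply: dE; rewrite // U'P ?nu ?nv.
  + have hy v : v \in U' -> h u0 v -> exists a b, [/\ a \in P y, b \in V v :|: P (x v) & e a b].
      move=> vU' hv; exists y, (x v); split; first by case: (hP y ybd).
        by rewrite in_setU; case: (xV v vU') => _ ->.
      by rewrite se yV.
    move=> u v uU vU; rewrite /V'; have [->|nu] := eqVneq u u0; have [->|nv] := eqVneq v u0.
    * by rewrite hirr.
    * by apply: hy; rewrite U'P nv.
    * rewrite hs => /hy[|a [b [ha hb hab]]]; first by rewrite U'P nu.
      by exists b, a; split; rewrite // se.
    by apply: eE; rewrite U'P ?nu ?nv.
- by move=> u uU; have [? ?] := x'P u uU; split; rewrite ?V'X.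
Qed.

Lemma rooted_forest_model (U0 : {set I}) : thin h U0 -> #|U0| <= n -> ~~ good setT ->
  exists V, model U0 V /\ {in U0, forall u, exists2 r, r \in V u & r \in R}.
Proof.
move=> thinU0 len ng.
have [X [V [x [mX cX [cV dV eV] xV]]]] := forest_model thinU0 (subxx _) len ng.
have [/andP[gX _] maxX] := maxsetP mX.
(* The branch sets reach [R] only now, through a linkage from [X] to [R :\: X];
   a small separator would enlarge [X]. *)
pose Q := R :\: X.
have bdQ : bd e Q X = bd0 X.
  apply/setP=> z; apply/bdP/bd0P => -[zX]; last by split=> //; right.
  by case=> [|//]; rewrite inE zX.
(* The boundary of [setT] is [Q] itself, since no vertex is outside; the linkage thus ends in
   [R]. *)
have [|P [hP dP]] := @linkage_exists _ e Q X setT se (subsetT X).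
  move=> Y XY _; rewrite bdQ leqNgt; apply/negP=> lt.
  have sY : bd0 Y \subset bd e Q Y.
    by apply/subsetP=> z /bd0P[zY hz]; apply/bdP; split=> //; right.
  have bY : #|bd0 Y| <= #|U0|.
    by rewrite -cX; apply: leq_trans (ltnW lt); apply: subset_leq_card.
  (* [bd e Q Y] contains both [bd0 Y] and the vertices of [R] gained from [X] to [Y], so its size
     bounds both quantities in [step]. *)
  have gY : good Y.
    apply: (good_step gX XY); first exact: leq_trans len.
    apply: leq_trans len; rewrite -cX; apply: leq_trans (ltnW lt).
    apply: subset_leq_card; apply/subsetP=> z /setIP[zR /setDP[zY zX]].
    by apply/bdP; split=> //; left; rewrite inE zX.
  have YX : Y = X by apply: maxX; rewrite ?gY.
  by move: lt; rewrite YX bdQ ltnn.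
rewrite bdQ in hP dP.
have xb u : u \in U0 -> x u \in bd0 X by case/xV.
exists (fun u => V u :|: P (x u)); split.
  apply: (model_extend (And3 cV dV eV) xV) => // z zb; have [? ? s _] := hP z zb; split=> //.
  apply/subsetP=> u /setIP[/(subsetP s)]; rewrite !inE.
  by case/orP=> [//|/andP[/negPf->]].
move=> u uU; have [_ _ _ [r rP rb]] := hP _ (xb u uU); exists r.
  by rewrite in_setU rP orbT.
by case/bdP: rb => _ [/setDP[]//|[y _]]; rewrite inE.
Qed.

End Model.
End RootedForest.

(** * Layered decompositions *)

Section Layout.
Variables (T : finType) (e : rel T).

(** The boundary of the initial segment up to position [k], as in vertex separation, with several
    vertices allowed at one position. *)
Definition cut (pos : T -> nat) k :=
  [set v | (pos v <= k) && [exists u, e v u && (k < pos u)]].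

Lemma good_layout (R : {set T}) n : good e R n setT ->
  exists pos : T -> nat, (forall k, #|cut pos k| <= n) /\
    (forall k, #|[set v in R | pos v == k]| <= n).
Proof.
(* Padding with [setT] lets every [k] satisfy [step], and the leading [set0] leaves no vertex at
   position 0. *)
move=> /connectP[s ps els]; pose F k := nth setT (set0 :: s) k.
have Fs : F (size s) = setT by rewrite /F -last_nth -els.
have Fbig k : size s <= k -> F k = setT.
  rewrite leq_eqVlt => /orP[/eqP<-//|lt]; first by rewrite /F nth_default.
have stepF k : step e R n (F k) (F k.+1).
  have [lt|le] := ltnP k (size s); first by have /(pathP setT)/(_ k lt) := ps.
  rewrite !Fbig ?(leq_trans le) // /step /= subxx bd0_setT cards0 /=.
  by rewrite setDv setI0 cards0.
have Fmono i j : i <= j -> F i \subset F j.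
  move=> ij; rewrite -(subnKC ij); elim: (j - i) => [|d IH]; first by rewrite addn0.
  by apply: subset_trans IH _; rewrite addnS; have /andP[] := stepF (i + d).
have ex v : exists k, v \in F k by exists (size s); rewrite Fs inE.
have [pos posE] : exists pos : T -> nat, forall v k, (v \in F k) = (pos v <= k).
  exists (fun v => ex_minn (ex v)) => v k; case: ex_minnP => m vm minm.
  by apply/idP/idP => [/minm//|mk]; apply: (subsetP (Fmono _ _ mk)).
exists pos; split=> k.
  suff -> : cut pos k = bd e set0 (F k).
    case: k => [|k]; last by have /and3P[] := stepF k.
    by rewrite /F /= bd0_set0 cards0.
  apply/setP=> v; apply/idP/bd0P; rewrite inE.
    case/andP=> vk /existsP[u /andP[vu uk]]; rewrite posE; split=> //.
    by exists u => //; rewrite posE -ltnNge.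
  rewrite posE => -[-> [u vu uk]]; apply/existsP; exists u.
  by rewrite vu ltnNge -posE.
case: k => [|k].
  rewrite (_ : [set v in R | pos v == 0] = set0) ?cards0 //.
  by apply/setP=> v; rewrite !inE -leqn0 -posE /F /= inE andbF.
have /and3P[_ _ le] := stepF k; apply: leq_trans le; apply: subset_leq_card.
apply/subsetP=> v; rewrite !inE !posE => /andP[-> /eqP->].
by rewrite ltnn leqnn.
Qed.

End Layout.

Section Combine.
Variables (T : finType) (e : rel T).
Hypothesis se : symmetric e.

(* The bag at [p] is [[set v in K | l v <= p <= r v]]; the last clause lets a
   decomposition of [K] be placed one layer below the vertices around [K]. *)
Definition layered (K : {set T}) c (l r L : T -> nat) :=
  [/\ {in K, forall v, l v <= r v},
      {in K &, forall u v, e u v -> l u <= r v},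
      {in K &, forall u v, e u v -> L u <= (L v).+1},
      (forall p i, #|[set v in K | (l v <= p <= r v) && (L v == i)]| <= c) &
      {in K, forall v, (exists2 u, u \notin K & e v u) -> L v = 0}].

(** Positions are mixed-radix numbers with a leading digit [p], then [q] below [N] and [a] below
    [W]; the last two digits never carry out of block [p]. *)
Lemma block_bound p q N W a : q < N -> a < W ->
  p * (N * W) <= (p * N + q) * W + a < p.+1 * (N * W).
Proof.
move=> qN aW; rewrite mulnDl -mulnA -addnA leq_addr /= mulSn addnC ltn_add2r.
by apply: (@leq_trans (q.+1 * W)); rewrite ?leq_mul2r ?qN ?orbT // mulSn addnC ltn_add2r.
Qed.

(** Dividing by [W] and reducing modulo [N] reads the slot number off the position [P]. *)
Lemma block_uniq p1 q1 p2 q2 N W a1 b1 a2 b2 P : q1 < N -> q2 < N -> b1 < W -> b2 < W ->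
  (p1 * N + q1) * W + a1 <= P <= (p1 * N + q1) * W + b1 ->
  (p2 * N + q2) * W + a2 <= P <= (p2 * N + q2) * W + b2 -> q1 = q2.
Proof.
move=> q1N q2N b1W b2W /andP[l1 r1] /andP[l2 r2].
have W0 : 0 < W by apply: leq_ltn_trans b1W.
have code p q b a : b < W -> (p * N + q) * W + a <= P -> P <= (p * N + q) * W + b ->
    P %/ W = p * N + q.
  move=> bW lP rP; apply/eqP; rewrite eqn_leq -ltnS ltn_divLR // leq_divRL //.
  rewrite mulSn; move: ((p * N + q) * W) lP rP => z lP rP; apply/andP; split; lia.
have := code _ _ _ _ b1W l1 r1; rewrite (code _ _ _ _ b2W l2 r2).
by move/(congr1 (modn^~ N)); rewrite !modnMDl !modn_small.
Qed.

(** Layer 0 is exactly [M], the layers of the components are raised by one, and no position lies in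
    the slots of two components. One layer of a bag thus meets either [M] alone or a single
    component, and [c] does not grow. *)
Lemma combine (K M : {set T}) c (lM rM : T -> nat) : M \subset K ->
  {in M, forall v, lM v <= rM v} ->
  {in M &, forall u v, e u v -> lM u <= rM v} ->
  (forall p, #|[set v in M | lM v <= p <= rM v]| <= c) ->
  (forall v u, v \in K -> u \notin K -> e v u -> v \in M) ->
  {in K :\: M, forall x : T, exists p, forall s v : T,
     s \in component e (K :\: M) x -> v \in M -> e s v -> lM v <= p <= rM v} ->
  {in K :\: M, forall x : T, exists l r L, layered (component e (K :\: M) x) c l r L} ->
  exists l r L, layered K c l r L.
Proof.
move=> MK hM1 hM2 hM3 hM4 hp hD; set S := K :\: M in hp hD.
have [p pP] : exists p : T -> nat, forall x, x \in S -> forall s v,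
    s \in component e S x -> v \in M -> e s v -> lM v <= p x <= rM v.
  apply: (@fin_all_exists _ (fun=> nat) (fun x q => x \in S -> forall s v,
     s \in component e S x -> v \in M -> e s v -> lM v <= q <= rM v)) => x.
  by have [/hp[q qP]|_] := boolP (x \in S); [exists q | exists 0].
have [D DP] : exists D : T -> (T -> nat) * (T -> nat) * (T -> nat),
    forall x, x \in S -> layered (component e S x) c (D x).1.1 (D x).1.2 (D x).2.
  apply: (@fin_all_exists _ (fun=> ((T -> nat) * (T -> nat) * (T -> nat))%type)
     (fun x D => x \in S -> layered (component e S x) c D.1.1 D.1.2 D.2)) => x.
  have [/hD[l [r [L h]]]|_] := boolP (x \in S); first by exists (l, r, L).
  by exists (lM, lM, lM).
have csym := sym_connect_sym (restr_sym S se).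
(* [p] and [D] were chosen per vertex; evaluating them at the root of a component makes the choice
   uniform on it. *)
pose rt := root (restr e S).
have rt_conn x : connect (restr e S) (rt x) x by rewrite csym connect_root.
have rtS x : x \in S -> rt x \in S.
  move=> xS; apply: (subsetP (component_sub e xS)).
  by rewrite inE csym.
have rt_comp x : x \in component e S (rt x) by rewrite inE.
have rtE u v : u \in S -> v \in S -> e u v -> rt u = rt v.
  move=> uS vS uv; apply/eqP; rewrite root_connect //; apply: connect1.
  by rewrite /restr /= uv uS vS.
have SM v : v \in K -> v \notin M -> v \in S by move=> vK vM; rewrite inE vM.
(* Position [q] of [M] becomes a block of [N * W] positions, in which each
   component with home [q] owns a slot of [W] positions. *)
pose W := (\max_x \max_y (D x).1.2 y).+1.
have DW x y : (D x).1.2 y < W.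
  rewrite ltnS; apply: leq_trans (leq_bigmax x).
  exact: (leq_bigmax y).
pose N := #|{: T}|; pose rk (x : T) : nat := enum_rank x.
have rkN x : rk x < N := ltn_ord _.
pose base x := (p x * N + rk x) * W.
pose l x := if x \in M then lM x * (N * W) else base (rt x) + (D (rt x)).1.1 x.
(* A vertex of [M] occupies whole blocks, up to the last position of block [rM x]. *)
pose r x := if x \in M then ((rM x).+1 * (N * W)).-1 else base (rt x) + (D (rt x)).1.2 x.
pose L x := if x \in M then 0 else ((D (rt x)).2 x).+1.
have B0 (x : T) : 0 < N * W by rewrite muln_gt0 (leq_ltn_trans _ (rkN x)).
have BS (x : T) k : 0 < k.+1 * (N * W) by rewrite muln_gt0 (B0 x).
have lr x : x \in S -> (D (rt x)).1.1 x <= (D (rt x)).1.2 x.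
  by move=> xS; have [h _ _ _ _] := DP _ (rtS _ xS); apply: h.
have MS u v : u \in K -> u \notin M -> v \in M -> e u v -> l u <= r v /\ l v <= r u.
  move=> uK uM vM uv; have uS := SM _ uK uM.
  have /andP[le1 le2] := pP _ (rtS _ uS) _ _ (rt_comp u) vM uv.
  rewrite /l /r (negPf uM) vM /base.
  have /andP[_ b1] := block_bound (p (rt u)) (rkN (rt u)) (leq_ltn_trans (lr _ uS) (DW _ _)).
  have /andP[b2 _] := block_bound (p (rt u)) (rkN (rt u)) (DW (rt u) u).
  split.
    rewrite -ltnS prednK ?(BS u) //; apply: leq_trans b1 _.
    by rewrite leq_mul2r ltnS le2 orbT.
  by apply: leq_trans b2; rewrite leq_mul2r le1 orbT.
exists l, r, L; split.
- move=> v vK; rewrite /l /r; have [vM|vM] := boolP (v \in M).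
    rewrite -ltnS prednK ?(BS v) // mulSn addnC -addn1 leq_add ?(B0 v) //.
    by rewrite leq_mul2r hM1 ?orbT.
  by rewrite leq_add2l lr // SM.
- move=> u v uK vK uv; have [uM|uM] := boolP (u \in M); have [vM|vM] := boolP (v \in M).
  + rewrite /l /r uM vM -ltnS prednK ?(BS v) // mulSn addnC -addn1 leq_add ?(B0 v) //.
    by rewrite leq_mul2r hM2 ?orbT.
  + by have [] := MS _ _ vK vM uM; rewrite // se.
  + by have [] := MS _ _ uK uM vM uv.
  have [uS vS] := (SM _ uK uM, SM _ vK vM).
  rewrite /l /r (negPf uM) (negPf vM) (rtE _ _ uS vS uv) leq_add2l.
  have [_ h _ _ _] := DP _ (rtS _ vS); apply: h => //.
  by rewrite -(rtE _ _ uS vS uv).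
- move=> u v uK vK uv; rewrite /L; have [//|uM] := boolP (u \in M); have [vM|vM] := boolP (v \in M).
    (* [u] has a neighbour outside its component, so the last clause of [layered] puts it in layer 0
       of the component, which is layer 1 here. *)
    have uS := SM _ uK uM; have [_ _ _ _ h] := DP _ (rtS _ uS); rewrite h //.
    exists v => //; apply: contraTN vM => /(subsetP (component_sub e (rtS _ uS))).
    by rewrite inE => /andP[].
  have [uS vS] := (SM _ uK uM, SM _ vK vM).
  have [_ _ h _ _] := DP _ (rtS _ vS); rewrite (rtE _ _ uS vS uv) ltnS; apply: h => //.
  by rewrite -(rtE _ _ uS vS uv).
- move=> P [|i].
    apply: leq_trans (hM3 (P %/ (N * W))); apply: subset_leq_card.
    apply/subsetP=> v; rewrite !inE /L /l /r => /and3P[vK]; case: ifP => //= vM.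
    rewrite leq_divRL ?(B0 v) // => /andP[-> /=] h _.
    rewrite -ltnS ltn_divLR ?(B0 v) //; apply: leq_ltn_trans h _.
    by rewrite prednK // (BS v).
  set X := [set v in K | _]; have [->|/set0Pn[x]] := eqVneq X set0; first by rewrite cards0.
  have XP v : v \in X -> [/\ v \in S, base (rt v) + (D (rt v)).1.1 v <= P <= base (rt v) + (D (rt v)).1.2 v
      & (D (rt v)).2 v = i].
    rewrite inE /L /l /r; case: ifP => [_|vM /and3P[vK -> /eqP[<-]]]; first by rewrite !andbF.
    by split=> //; apply: SM; rewrite ?vM.
  move=> /XP[xS hx Lx]; have [_ _ _ h _] := DP _ (rtS _ xS).
  apply: leq_trans (h (P - base (rt x)) i); apply: subset_leq_card.
  apply/subsetP=> v /XP[vS hv Lv].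
  (* The slot number of [P] identifies the component, so the bound for one component covers this
     layer of the bag. *)
  have erk : rk (rt v) = rk (rt x) by apply: block_uniq hv hx.
  have ert : rt v = rt x by apply: enum_rank_inj; apply: val_inj.
  rewrite ert in hv Lv; rewrite inE -{1}ert rt_comp Lv eqxx andbT /=.
  by move: hv; lia.
- by move=> v vK [u uK vu]; rewrite /L (hM4 _ _ vK uK vu).
Qed.

End Combine.

(** * Separating off one layer *)

Section Separator.
Variables (T : finType) (e : rel T).
Hypothesis se : symmetric e.

Definition contacts (K O : {set T}) := [set v in K | [exists o in O, e v o]].

(* If a component [C] of [K :\: M] separates one of its neighbours from [O], the
   whole side of that neighbour is removed from [M] and merged into [C], which
   thereby gains no neighbours. *)
Lemma shrink (K O : {set T}) o (l r : T -> nat) : conn e O -> o \in O ->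
  [disjoint K & O] -> (forall v u, v \in K -> u \notin K -> e v u -> u \in O) ->
  let cond (M : {set T}) := [/\ contacts K O \subset M, M \subset K &
    forall S : {set T}, conn e S -> S \subset K :\: M ->
      exists p, forall s v, s \in S -> v \in M -> e s v -> l v <= p <= r v] in
  forall M, cond M -> exists M' : {set T}, [/\ M' \subset M, cond M' &
    forall x s u, x \in K :\: M' -> s \in component e (K :\: M') x ->
      u \notin component e (K :\: M') x -> e s u ->
      u \in component e (~: component e (K :\: M') x) o].
Proof.
move=> cO oO dKO leave cond M; have [m] := ubnP #|M|; elim: m => // m IH in M *.
rewrite ltnS => lem [RM MK hM].
have [|noBad] := boolP [exists x in K :\: M, exists s in component e (K :\: M) x, exists u,
    [&& u \notin component e (K :\: M) x, e s u & u \notin component e (~: component e (K :\: M) x) o]];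
  last first.
  exists M; split=> // x s u xS sC uC su; apply: contraR noBad => uo.
  apply/existsP; exists x; rewrite xS; apply/existsP; exists s; rewrite sC.
  by apply/existsP; exists u; rewrite uC su.
case/existsP=> x /andP[xS] /existsP[s /andP[sC] /existsP[u /and3P[uC su uo]]].
set C := component e (K :\: M) x in sC uC uo.
have CS : C \subset K :\: M := component_sub e xS.
have CK : C \subset K by apply: subset_trans CS (subsetDl _ _).
have uCc : u \in ~: C by rewrite inE.
have OC : O \subset ~: C.
  apply/subsetP=> z zO; rewrite inE; apply/negP=> /(subsetP CK).
  by rewrite (disjointFl dKO zO).
have oC := subsetP OC _ oO.
have Oo : O \subset component e (~: C) o := component_max cO oO OC.
(* [D] is the side of [u] beyond [C]; it avoids the component of [o], hence [O] and all contacts of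
   [O]. *)
set D := component e (~: C) u.
have csym := sym_connect_sym (restr_sym (~: C) se).
have Do z : z \in D -> z \notin component e (~: C) o.
  rewrite !inE => uz; apply: contra uo => oz; rewrite inE.
  by apply: connect_trans oz _; rewrite csym.
have uK : u \in K.
  by apply: contraR uo => uK; apply: (subsetP Oo); apply: (leave s) => //; apply: (subsetP CK).
have uM : u \in M.
  by apply: contraR uC => uM; apply: (component_closed xS sC _ su); rewrite inE uM.
have DC z : z \in D -> z \notin C.
  by move/(subsetP (component_sub e uCc)); rewrite inE.
have DR z : z \in D -> z \notin contacts K O.
  move=> zD; apply/negP; rewrite inE => /andP[_ /existsP[o' /andP[o'O zo']]].
  case/negP: (Do z zD); apply: (component_closed oC (subsetP Oo _ o'O)); last by rewrite se.
  by rewrite inE DC.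
have M1P z : (z \in M :\: D) = (z \notin D) && (z \in M) by rewrite in_setD.
have [||M' [M'M cM' hM']] := IH (M :\: D).
- apply: leq_trans lem; apply: proper_card; rewrite properE subsetDl /=.
  by apply/subsetPn; exists u; rewrite // M1P component_refl.
- split.
  + apply/subsetP=> z zR; rewrite M1P (subsetP RM) // andbT.
    by apply: contraL zR; apply: DR.
  + by apply: subset_trans MK; apply: subsetDl.
  move=> S cS SK; have SP z : z \in S -> z \in K /\ (z \notin D -> z \notin M).
    by move/(subsetP SK); rewrite in_setD M1P negb_and negbK => /andP[h ->]; split=> // /negPf zD; rewrite zD in h.
  have [dSD|/pred0Pn[z /andP[/= zS zD]]] := boolP [disjoint S & D].
    have [|p pP] := hM S cS.
      apply/subsetP=> z zS; have [zK zM] := SP z zS.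
      by rewrite inE zK zM // (disjointFr dSD zS).
    by exists p => s' v s'S; rewrite M1P => /andP[_]; apply: pP.
  (* [D] has no neighbour outside [C :|: D], and [S] cannot leave [C] except into [D]; hence the
     neighbours of [S] in [M :\: D] are neighbours of [C], whose position serves. *)
  have SCD : S \subset C :|: D.
    apply: (conn_closed (x := z) _ cS zS); last by rewrite in_setU zD orbT.
    move=> a b aS bS ab; rewrite !in_setU.
    have [//|bD] := boolP (b \in D); first by rewrite orbT.
    have [bK bM] := SP b bS; case/orP=> [aC|aD].
      by rewrite (component_closed xS aC _ ab) // in_setD bM.
    have [//|bC] := boolP (b \in C); case/negP: bD.
    by apply: (component_closed uCc aD _ ab); rewrite inE.
  have [p pP] := hM C (conn_component se xS) CS.
  exists p => s' v s'S; rewrite M1P => /andP[vD vM] s'v.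
  have /setUP[s'C|s'D] := subsetP SCD _ s'S; first exact: pP s'C vM s'v.
  case/negP: vD; apply: (component_closed uCc s'D _ s'v); rewrite inE.
  by apply: contraTN vM => /(subsetP CS); rewrite inE => /andP[].
by exists M'; split=> //; apply: subset_trans M'M (subsetDl _ _).
Qed.

Variables (I : finType) (h : rel I) (U0 : {set I}) (n : nat).
Hypotheses (hs : symmetric h) (hirr : irreflexive h) (thinU0 : thin h U0).
Hypotheses (n0 : 0 < n) (leU0 : #|U0| <= n).
Hypothesis no_model : forall (K O : {set T}) V, conn e O -> O != set0 -> [disjoint K & O] ->
  model (restr e K) h U0 V ->
  {in U0, forall u, exists2 r, r \in V u & r \in contacts K O} -> False.

(** A layout with small cuts exists because no rooted model does. [M] starts as the contacts
    together with the vertices that have a later neighbour in [K], so outside it positions are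
    constant along edges; [shrink] then puts the neighbours of each component in one connected
    set. *)
Lemma separator (K O : {set T}) : K != set0 -> conn e O -> [disjoint K & O] ->
  (forall v u, v \in K -> u \notin K -> e v u -> u \in O) ->
  exists (M : {set T}) (l r : T -> nat), [/\ M \subset K, M != set0,
    [/\ {in M, forall v, l v <= r v},
        {in M &, forall u v, e u v -> l u <= r v} &
        forall p, #|[set v in M | l v <= p <= r v]| <= 3 * n],
    forall v u, v \in K -> u \notin K -> e v u -> v \in M &
    {in K :\: M, forall x : T,
      (exists p, forall s v : T,
        s \in component e (K :\: M) x -> v \in M -> e s v -> l v <= p <= r v) /\
      exists O' : {set T}, [/\ conn e O', [disjoint component e (K :\: M) x & O'] &
        forall s u, s \in component e (K :\: M) x -> u \notin component e (K :\: M) x ->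
          e s u -> u \in O']}].
Proof.
move=> Kn0 cO dKO leave; set R := contacts K O.
have leaveR v u : v \in K -> u \notin K -> e v u -> v \in R.
  move=> vK uK vu; rewrite inE vK; apply/existsP; exists u.
  by rewrite vu (leave v u).
have [R0|/set0Pn[r0 r0R]] := eqVneq R set0.
  (* Without contacts no edge leaves [K]; any single vertex is a valid [M] and makes the recursion
     progress. *)
  have [a aK] := set0Pn _ Kn0; exists [set a], (fun=> 0), (fun=> 0).
  have leave0 v u : v \in K -> e v u -> u \in K.
    by move=> vK vu; have [//|uK] := boolP (u \in K); move: (leaveR v u vK uK vu); rewrite R0 inE.
  split; [by rewrite sub1set | by apply/set0Pn; exists a; rewrite inE | split=> // p | |].
  - apply: leq_trans (_ : 1 <= _); last by lia.
    by rewrite -(cards1 a) subset_leq_card //; apply/subsetP=> v; rewrite inE => /andP[].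
  - by move=> v u vK uK /(leave0 _ _ vK); rewrite (negPf uK).
  move=> x xS; split; first by exists 0.
  exists [set a]; split; first exact: conn1.
    rewrite disjoint_sym disjoints1; apply/negP => /(subsetP (component_sub e xS)).
    by rewrite !inE eqxx.
  move=> s u sC uC su; have sK : s \in K by move: (subsetP (component_sub e xS) _ sC); rewrite inE => /andP[].
  rewrite inE; apply: contraR uC => ua; apply: (component_closed xS sC _ su).
  by rewrite !inE ua (leave0 s).
have [o oO] : exists o, o \in O by move: r0R; rewrite inE => /andP[_ /existsP[o /andP[oO _]]]; exists o.
have sK : symmetric (restr e K) := restr_sym K se.
have gT : good (restr e K) R n setT.
  apply: contraT => ng.
  have [V [mV rV]] := rooted_forest_model sK hs hirr thinU0 leU0 ng.
  by case: (no_model cO _ dKO mV rV); apply/set0Pn; exists o.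
have [pos [cutn Rn]] := good_layout gT.
(* [v] stays in the bags until its last neighbour in [K] has appeared. *)
pose r v := \max_(u | (u == v) || restr e K v u) pos u.
have lr v : pos v <= r v by apply: (@leq_bigmax_cond _ _ pos); rewrite eqxx.
have er u v : u \in K -> v \in K -> e u v -> pos u <= r v.
  by move=> uK vK uv; apply: (@leq_bigmax_cond _ _ pos); rewrite /restr /= se uv uK vK orbT.
pose M0 := R :|: [set v in K | [exists u, restr e K v u && (pos v < pos u)]].
have M0K : M0 \subset K.
  by apply/subsetP=> v /setUP[]; rewrite inE => /andP[].
have late u v : u \in K -> v \in K -> e u v -> u \notin M0 -> pos v <= pos u.
  move=> uK vK uv; apply: contraR; rewrite -ltnNge => lt.
  rewrite in_setU [X in _ || X]inE uK; apply/orP; right; apply/existsP; exists v.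
  by rewrite lt /restr /= uv uK vK.
have cond0 (S : {set T}) : conn e S -> S \subset K :\: M0 ->
    exists p, forall s v, s \in S -> v \in M0 -> e s v -> pos v <= p <= r v.
  move=> cS SK; have [->|/set0Pn[x xS]] := eqVneq S set0.
    by exists 0 => s v; rewrite inE.
  have SP z : z \in S -> z \in K /\ z \notin M0 by move/(subsetP SK); rewrite in_setD => /andP[].
  (* Neither end of an edge outside [M0] is later than the other, by [late] in both directions. *)
  have posS s : s \in S -> pos s = pos x.
    suff /subsetP sub : S \subset [set s | pos s == pos x].
      by move/sub; rewrite inE => /eqP.
    apply: (conn_closed _ cS xS); last by rewrite inE.
    move=> u v uS vS uv; rewrite !inE => /eqP <-.
    have [[uK uM] [vK vM]] := (SP u uS, SP v vS).
    by rewrite eqn_leq !late // se.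
  exists (pos x) => s v sS vM sv; have [sKK sM] := SP s sS; rewrite -(posS s sS).
  by rewrite late ?er // (subsetP M0K).
have [|M [MM0 [RM MK hM] hO]] := shrink cO oO dKO leave (M := M0) (l := pos) (r := r).
  by split=> //; apply: subsetUl.
exists M, pos, r; split=> //.
- by apply/set0Pn; exists r0; apply: (subsetP RM).
- split=> [v _ | u v uM vM uv | p]; first exact: lr.
    by apply: er => //; apply: (subsetP MK).
  pose A1 := [set v in R | pos v == p].
  (* A vertex of [M] in bag [p] is in [R] at position [p], or at [p] with a later neighbour, or
     before [p] with a neighbour at [p] or later; this is the factor 3. *)
  apply: leq_trans (_ : #|A1 :|: cut (restr e K) pos p :|: cut (restr e K) pos p.-1| <= _).
    apply: subset_leq_card; apply/subsetP=> v; rewrite inE => /and3P[vM vp pv].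
    rewrite !in_setU; move: vp; rewrite leq_eqVlt => /orP[/eqP vp|vp].
      have := subsetP MM0 _ vM; rewrite in_setU => /orP[vR|]; first by rewrite inE vR vp eqxx.
      rewrite inE => /andP[_ hv]; apply/orP; left; apply/orP; right.
      by rewrite inE vp leqnn -vp.
    apply/orP; right; rewrite inE -ltnS prednK; last exact: leq_ltn_trans vp.
    rewrite vp /=.
    apply: contraLR pv => /existsPn no; rewrite -ltnNge.
    have p0 : 0 < p by apply: leq_ltn_trans vp.
    rewrite -(prednK p0) ltnS; apply/bigmax_leqP => u /orP[/eqP->|vu].
      by rewrite -ltnS prednK.
    by move: (no u); rewrite vu /= -ltnNge => lt; rewrite -ltnS prednK.
  rewrite (_ : 3 * n = n + n + n); last by lia.
  apply: leq_trans (leq_card_setU _ _) _; apply: leq_add (cutn _).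
  by apply: leq_trans (leq_card_setU _ _) _; apply: leq_add (Rn p) (cutn p).
- by move=> v u vK uK vu; apply: (subsetP RM); apply: leaveR vu.
move=> x xS; have CS := component_sub e xS; split; first by apply: hM => //; apply: conn_component.
exists (component e (~: component e (K :\: M) x) o).
have oC : o \in ~: component e (K :\: M) x.
  rewrite in_setC; apply/negP => /(subsetP CS); rewrite in_setD => /andP[_].
  by rewrite (disjointFl dKO oO).
split; first exact: conn_component.
  by rewrite disjoint_sym disjoints_subset; apply: component_sub.
by move=> s u; apply: hO.
Qed.

(** Induction on [#|K|]: [M] is not empty, so components are smaller, and the outside neighbours of
    each lie in a connected set of its own. *)
Lemma layered_exists (K O : {set T}) : conn e O -> [disjoint K & O] ->
  (forall v u, v \in K -> u \notin K -> e v u -> u \in O) ->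
  exists l r L, layered e K (3 * n) l r L.
Proof.
have [m] := ubnP #|K|; elim: m => // m IH in K O *; rewrite ltnS => lem cO dKO leave.
have [->|Kn0] := eqVneq K set0.
  exists (fun=> 0), (fun=> 0), (fun=> 0); split; try by move=> u; rewrite inE.
  move=> p i; rewrite (_ : [set v in _ | _] = set0) ?cards0 //.
  by apply/setP=> v; rewrite !inE.
have [M [l [r [MK Mn0 [h1 h2 h3] h4 hC]]]] := separator Kn0 cO dKO leave.
apply: (combine se MK h1 h2 h3 h4) => x xS; first by have [] := hC x xS.
have [_ [O' [cO' dO' lO']]] := hC x xS; apply: IH cO' dO' lO'.
apply: leq_trans lem; apply: proper_card.
apply: sub_proper_trans (component_sub e xS) _; rewrite properE subsetDl /=.
have [z zM] := set0Pn _ Mn0; apply/subsetPn; exists z; first exact: (subsetP MK).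
by rewrite inE zM.
Qed.

End Separator.

(** * Excluding an apex-forest bounds layered pathwidth *)

(** If every vertex of [U] had two neighbours in [U], a path in [U] could be prolonged for ever,
    since a repeated vertex would close a cycle. *)
Lemma acyclic_thin (I : finType) (h : rel I) (U0 : {set I}) :
  symmetric h -> irreflexive h ->
  (forall c, 3 <= size c -> uniq c -> {subset c <= U0} -> ~~ cycle h c) ->
  thin h U0.
Proof.
move=> hs hirr acyc U UU0 Un0.
have [/existsP[u /andP[uU /forallP thu]]|/existsPn noThin] := boolP [exists u,
    (u \in U) && [forall a, forall b, [&& a \in U, b \in U, h u a & h u b] ==> (a == b)]].
  exists u => // a b aU bU ha hb.
  by move/forallP/(_ b): (thu a); rewrite aU bU ha hb => /eqP.
have nbr u z : u \in U -> exists y, [/\ y \in U, h u y & y != z].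
  move=> uU; have := noThin u; rewrite uU => /forallPn[a /forallPn[b]].
  rewrite negb_imply => /andP[/and4P[aU bU ha hb] ab].
  by have [az|] := eqVneq a z; [exists b; rewrite eq_sym -az | exists a].
have long m : exists x p, [/\ size p = m, path h x p, uniq (x :: p) & {subset x :: p <= U}].
  elim: m => [|m [x [p [sp hp up pU]]]].
    have [x xU] := set0Pn _ Un0; exists x, [::]; split=> // y.
    by rewrite inE => /eqP->.
  have xU : x \in U by apply: pU; rewrite inE eqxx.
  (* [y] avoids the second vertex of the path; for a one-vertex path the default [x] is harmless, as
     [h] is irreflexive. *)
  have [y [yU hy yz]] := nbr x (head x p) xU.
  exists y, (x :: p); split; rewrite /= ?sp ?hp ?andbT //; first by rewrite hs.
    rewrite [X in _ && X]up andbT; apply/negP; rewrite inE => /orP[/eqP yx|yp].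
      by rewrite yx hirr in hy.
    case: p => [//|z p] in sp hp up pU yz yp.
    move: yp; rewrite inE (negPf yz) /= => yp; case/splitPr: yp => p1 p2 in sp hp up pU.
    have e1 : x :: z :: p1 ++ y :: p2 = (x :: z :: rcons p1 y) ++ p2.
      by rewrite /= cat_rcons.
    apply: (negP (acyc (x :: z :: rcons p1 y) _ _ _)) => //=.
    - by rewrite size_rcons.
    - by move: up; rewrite e1 cat_uniq => /and3P[].
    - move=> t tc; apply: (subsetP UU0); apply: pU.
      by rewrite e1 mem_cat tc.
    move: hp => /= /andP[-> ]; rewrite -cat_rcons cat_path => /andP[hz _].
    by rewrite rcons_path last_rcons hz hs hy.
  by move=> t; rewrite inE => /orP[/eqP->//|/pU].
(* A path with [#|I|] edges has one vertex too many. *)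
have [x [p [sp _ /card_uniqP + _]]] := long #|I|.
by rewrite /= sp => c; move: (max_card (mem (x :: p))); rewrite c ltnn.
Qed.

Lemma layered_lpw (G : graph) c l r L :
  layered (gadj G) setT c l r L -> lpw_le G c.
Proof.
move=> [lr ov lay wid _]; pose N := (\max_v r v).+1.
have rN v : r v < N by rewrite ltnS; apply: (leq_bigmax v).
pose bag k := [set v | l v <= k <= r v].
exists (mkseq bag N); split; first split.
(* Two overlapping intervals share the larger of their left ends. *)
- move=> u v uv; exists (maxn (l u) (l v)); rewrite size_mkseq.
  have luN : maxn (l u) (l v) < N.
    rewrite gtn_max; apply/andP.
    by split; [apply: leq_ltn_trans (rN u) | apply: leq_ltn_trans (rN v)]; apply: lr; rewrite inE.
  have uv1 : l u <= r v by apply: ov; rewrite ?inE.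
  have vu1 : l v <= r u by apply: ov; rewrite ?inE // gsym.
  rewrite !nth_mkseq // !inE !leq_max !leqnn geq_max orbT /=.
  by rewrite geq_max uv1 vu1 !lr ?inE.
- move=> v; exists (l v), (r v); rewrite size_mkseq lr ?inE // rN; split=> //.
  by split=> // k kN; rewrite nth_mkseq // inE.
exists L; split=> [u v uv|_ i /mapP[k _ ->]].
  by split; apply: lay; rewrite ?inE // gsym.
apply: leq_trans (wid k i); apply: subset_leq_card; apply/subsetP=> v.
by rewrite !inE.
Qed.

(** [O] becomes the branch set of the apex [v]; each other branch set has a contact, which realises
    any edge at [v]. *)
Lemma apex_model_minor (H G : graph) (v : 'I_(gn H)) (K O : {set 'I_(gn G)}) V :
  conn (gadj G) O -> O != set0 -> [disjoint K & O] ->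
  model (restr (gadj G) K) (gadj H) [set~ v] V ->
  {in [set~ v], forall u, exists2 r, r \in V u & r \in contacts (gadj G) K O} ->
  is_minor H G.
Proof.
move=> cO On0 dKO [cV dV eV] rV.
have nv u : u != v -> u \in [set~ v] by rewrite !inE.
(* [V u] contains a vertex of [K] and is connected by edges inside [K]. *)
have VK u : u != v -> V u \subset K.
  move=> uv; have [r rVu] := rV u (nv u uv); rewrite inE => /andP[rK _].
  by apply: (conn_closed _ (cV u (nv u uv)) rVu rK) => a b _ _ /and3P[].
have VO u : u != v -> [disjoint V u & O].
  by move=> uv; apply: disjointWl dKO; apply: VK.
have touch u : u != v -> exists x y, [/\ x \in O, y \in V u & gadj G x y].
  move=> uv; have [r rVu] := rV u (nv u uv); rewrite inE => /andP[_ /existsP[o /andP[oO ro]]].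
  by exists o, r; rewrite gsym.
exists (fun u => if u == v then O else V u); split.
- move=> u; have [//|uv] := eqVneq u v; have [r rVu _] := rV u (nv u uv).
  by apply/set0Pn; exists r.
- move=> a b ab; have [ea|na] := eqVneq a v; have [eb|nb] := eqVneq b v.
  + by rewrite ea eb eqxx in ab.
  + by rewrite disjoint_sym VO.
  + exact: VO.
  by apply: dV => //; apply: nv.
- move=> u; case: eqVneq => // uv.
  by apply: sub_conn (cV u (nv u uv)) => a b /and3P[].
move=> a b; have [->|na] := eqVneq a v; have [->|nb] := eqVneq b v.
- by rewrite girr.
- by move=> _; apply: touch.
- by move=> _; have [x [y [xO yV xy]]] := touch a na; exists y, x; rewrite gsym.
move=> hab; have [x [y [xV yV /and3P[xy _ _]]]] := eV a b (nv a na) (nv b nb) hab.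
by exists x, y.
Qed.

Lemma apex_forest_minor_free_lpw (H G : graph) : apex_forest H -> ~ is_minor H G ->
  lpw_le G (3 * gn H).
Proof.
move=> [v fv] nm.
have n0 : 0 < gn H by apply: leq_ltn_trans (ltn_ord v).
have thinH : thin (gadj H) [set~ v].
  apply: acyclic_thin; [exact: gsym | exact: girr |] => c c3 uc cv; apply: fv => //.
  by apply/negP=> /cv; rewrite !inE eqxx.
have le : #|[set~ v]| <= gn H by rewrite -[leqRHS]card_ord max_card.
(* The recursion starts from the whole vertex set with nothing outside. *)
have [||||l [r [L lay]]] := @layered_exists _ (gadj G) (@gsym G) _ _ _ _
    (@gsym H) (@girr H) thinH n0 le _ setT set0 => //.
- by move=> K O V cO On0 dKO mV rV; apply: nm; apply: apex_model_minor mV rV.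
- exact: conn0.
- by rewrite -setI_eq0 setI0.
- by move=> a b _; rewrite inE.
exact: layered_lpw lay.
Qed.

(** * Apex-forests of large layered pathwidth *)

(** A highest vertex of a cycle has two distinct neighbours on it, neither of them higher. *)
Lemma unique_lower_acyclic (I : finType) (h : rel I) (ht : I -> nat) (c : seq I) :
  symmetric h -> 3 <= size c -> uniq c ->
  {in c & &, forall x a b, h x a -> h x b -> ht a <= ht x -> ht b <= ht x -> a = b} ->
  ~~ cycle h c.
Proof.
move=> hs c3 uc low; apply/negP=> cyc.
have [x0 x0c] : exists x0, x0 \in c by case: c c3 {uc low cyc} => // x c; exists x; rewrite inE eqxx.
have [x xc maxx] := @arg_maxnP _ x0 (mem c) ht x0c.
have [i p ec] := rot_to xc.
have mc : rot i c =i c by apply: mem_rot.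
move: c3 uc cyc; rewrite -(size_rot i) -(rot_uniq i) -(rot_cycle i) ec.
case: p ec => [|a p] // ec; case/lastP: p ec => [|p b] // ec _.
have inc y : y \in x :: a :: rcons p b -> y \in c by rewrite -ec mc.
have ac : a \in c by apply: inc; rewrite !inE eqxx orbT.
have bc : b \in c by apply: inc; rewrite !inE mem_rcons inE eqxx !orbT.
rewrite /= !inE !mem_rcons !rcons_path last_rcons !inE => /and3P[_ ab _] /and3P[xa _ bx].
have eab : a = b by apply: (low x a b) => //; [rewrite hs | apply: maxx | apply: maxx].
by rewrite eab eqxx in ab.
Qed.

(** If no interval of a vertex of [S] contained [p], a walk in [S] could not pass from intervals
    left of [p] to intervals right of it. *)
Lemma connected_bag (T : finType) (e : rel T) (S : {set T}) (l r : T -> nat) x y p :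
  (forall u v, e u v -> l v <= r u) -> x \in S -> connect (restr e S) x y ->
  l x <= p -> p <= r y -> exists2 z, z \in S & l z <= p <= r z.
Proof.
move=> ov xS xy lx ry.
have [/existsP[z /andP[zS zp]]|/existsPn no] :=
  boolP [exists z, (z \in S) && (l z <= p <= r z)]; first by exists z.
suff : y \in [set z | r z < p] by rewrite inE ltnNge ry.
apply: (connect_closed _ xy); last first.
  by move: (no x); rewrite xS lx /= -ltnNge inE.
move=> u v uS vS uv; rewrite !inE => up; move: (no v) (ov _ _ uv).
by rewrite vS /=; lia.
Qed.

Lemma middle3 (p : 'I_3 -> nat) : exists i j k, [/\ i != j, k != j & p i <= p j <= p k].
Proof.
pose a : 'I_3 := inord 0; pose b : 'I_3 := inord 1; pose c : 'I_3 := inord 2.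
have ab : (a == b) = false by rewrite -val_eqE /= !inordK.
have bc : (b == c) = false by rewrite -val_eqE /= !inordK.
have ac : (a == c) = false by rewrite -val_eqE /= !inordK.
have H := (ab, bc, ac, eq_sym b a, eq_sym c b, eq_sym c a).
have [h1|/ltnW h1] := leqP (p a) (p b); have [h2|/ltnW h2] := leqP (p b) (p c);
  have [h3|/ltnW h3] := leqP (p a) (p c).
- by exists a, b, c; rewrite !H h1 h2.
- by exists a, b, c; rewrite !H h1 h2.
- by exists a, c, b; rewrite !H h3 h2.
- by exists c, a, b; rewrite !H h3 h1.
- by exists b, a, c; rewrite !H h3 h1.
- by exists b, c, a; rewrite !H h3 h2.
- by exists c, b, a; rewrite !H h1 h2.
- by exists c, b, a; rewrite !H h1 h2.
Qed.

(* Three copies of a tree under a new root: of the large bags of the copies, the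
   middle one also meets the connected union of the root and the other copies. *)
Lemma wide_tree d : exists (T : finType) (e : rel T) (rt : T) (ht : T -> nat),
  [/\ symmetric e, irreflexive e, (forall x, connect e x rt),
      (forall y, e rt y -> ht rt < ht y) /\
      (forall x a b, e x a -> e x b -> ht a <= ht x -> ht b <= ht x -> a = b) &
      forall l r : T -> nat, (forall v, l v <= r v) ->
        (forall u v, e u v -> l v <= r u) ->
        exists p, d < #|[set v | l v <= p <= r v]|].
Proof.
elim: d => [|d [T [e [rt [ht [se ie ce [lowrt low] wide]]]]]].
  exists unit, (fun _ _ => false), tt, (fun=> 0); split=> //; first by case.
  move=> l r lr _; exists (l tt); apply/card_gt0P; exists tt.
  by rewrite inE leqnn lr.
pose e' (x y : option ('I_3 * T)) := match x, y with
  | None, None => false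
  | None, Some v => v.2 == rt
  | Some u, None => u.2 == rt
  | Some u, Some v => (u.1 == v.1) && e u.2 v.2 end.
pose ht' (x : option ('I_3 * T)) := if x is Some u then (ht u.2).+1 else 0.
have se' : symmetric e' by case=> [[i x]|] [[j y]|] //=; rewrite se eq_sym.
have copy i (S : {set option ('I_3 * T)}) x : (forall y, Some (i, y) \in S) -> None \in S ->
    connect (restr e' S) (Some (i, x)) None.
  move=> iS NS; apply: (@connect_trans _ _ (Some (i, rt))); last first.
    by apply: connect1; rewrite /restr /= eqxx iS NS.
  have /connectP[p] := ce x; elim: p x => [|z p IH] x /=; first by move=> _ ->.
  case/andP=> xz pz rz; apply: connect_trans (IH z pz rz); apply: connect1.
  by rewrite /restr /= eqxx xz !iS.
exists (option ('I_3 * T)), e', None, ht'; split=> //.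
- by case=> [[i x]|] //=; rewrite ie andbF.
- case=> [[i x]|]; last exact: connect0.
  apply: (connect_sub _ (copy i setT x _ _)) => [u v /and3P[uv _ _]|y|].
  + exact: connect1.
  + by rewrite inE.
  + by rewrite inE.
(* The root of a copy has only higher neighbours in the copy, by [lowrt], so the new root is its
   only neighbour that is not higher. *)
- split; first by case=> [[i y]|].
  case=> [[i x]|] [[j a]|] [[k b]|] //=; rewrite !ltnS.
  + by move=> /andP[/eqP<- xa] /andP[/eqP<- xb] ha hb; rewrite (low x a b).
  + by move=> /andP[_ xa] /eqP xrt; rewrite xrt in xa *; rewrite leqNgt lowrt.
  + by move=> /eqP xrt /andP[_ xb] _; rewrite xrt in xb *; rewrite leqNgt lowrt.
move=> l r lr ov.
have [p pP] : exists p : 'I_3 -> nat,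
    forall i, d < #|[set v | l (Some (i, v)) <= p i <= r (Some (i, v))]|.
  apply: (@fin_all_exists _ (fun=> nat) (fun i q =>
    d < #|[set v | l (Some (i, v)) <= q <= r (Some (i, v))]|)) => i.
  by apply: wide => [v|u v uv]; [apply: lr | apply: ov; rewrite /= eqxx].
have [i [j [k [ij kj /andP[pij pjk]]]]] := middle3 p.
(* Everything outside copy [j]; the new root connects copies [i] and [k] within it. *)
pose S := [set x : option ('I_3 * T) | if x is Some u then u.1 != j else true].
have alive m : exists x, l (Some (m, x)) <= p m <= r (Some (m, x)).
  have /card_gt0P[x] : 0 < #|[set v | l (Some (m, v)) <= p m <= r (Some (m, v))]|.
    by apply: leq_ltn_trans (pP m).
  by rewrite inE => xP; exists x.
have [[x /andP[lx _]] [y /andP[_ ry]]] := (alive i, alive k).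
have [||||z zS zp] := @connected_bag _ e' S l r (Some (i, x)) (Some (k, y)) (p j) ov.
- by rewrite inE.
- have csym := sym_connect_sym (restr_sym S se').
  apply: (@connect_trans _ _ None); last rewrite csym.
    by apply: copy => [t|]; rewrite inE.
  by apply: copy => [t|]; rewrite inE.
- exact: leq_trans pij.
- exact: leq_trans ry.
exists (p j); pose X := [set v | l (Some (j, v)) <= p j <= r (Some (j, v))].
apply: (@leq_trans #|z |: [set Some (j, v) | v in X]|).
  rewrite cardsU1 card_imset; last by move=> u v [].
  rewrite (_ : z \notin _); first by rewrite add1n ltnS; apply: pP.
  by apply/imsetP => -[v _ zv]; rewrite zv inE eqxx in zS.
apply: subset_leq_card; apply/subsetP=> v; rewrite in_setU1 inE => /orP[/eqP->//|].
by case/imsetP=> w + ->; rewrite inE.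
Qed.

Lemma wide_apex_forest c : exists G : graph, apex_forest G /\ ~ lpw_le G c.
Proof.
(* The value [3 * c] matches three layers with at most [c] vertices each. *)
have [T [e [rt [ht [se ie _ [_ low] wide]]]]] := wide_tree (3 * c).
pose adj (x y : option T) := match x, y with
  | None, None => false | None, Some _ => true | Some _, None => true
  | Some u, Some v => e u v end.
pose A : rel 'I_#|{: option T}| := [rel i j | adj (enum_val i) (enum_val j)].
have As : symmetric A by move=> i j; rewrite /A /=; case: enum_val => [u|]; case: enum_val => [v|] //=.
have Ai : irreflexive A by move=> i; rewrite /A /=; case: enum_val => [u|] //=.
pose G := Graph As Ai; pose apex : 'I_(gn G) := enum_rank (@None T).
pose f (x : T) : 'I_(gn G) := enum_rank (Some x).
have finj : injective f by move=> x y /enum_rank_inj[].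
exists G; split.
  exists apex => s s3 us apexs.
  pose Ht (i : 'I_(gn G)) := if enum_val i is Some x then ht x else 0.
  apply: (@unique_lower_acyclic _ (gadj G) Ht) => // x a b xs as_ bs.
  have fromT y : y \in s -> exists t, enum_val y = Some t.
    case E: (enum_val y) => [t|] ys; first by exists t.
    by case/negP: apexs; rewrite /apex -E enum_valK.
  have [[tx ex] [[ta ea] [tb eb]]] := (fromT x xs, (fromT a as_, fromT b bs)).
  rewrite /= /A /= /Ht ex ea eb /= => xa xb ha hb.
  by apply: enum_val_inj; rewrite ea eb (low tx ta tb).
move=> [bags [[bagE bagV] [L [Llay Lw]]]].
have [l lP] : exists l : T -> nat, forall v, exists j, l v <= j /\ j < size bags /\
        forall k, k < size bags -> (f v \in nth set0 bags k) = (l v <= k <= j).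
  exact: (@fin_all_exists _ (fun=> nat) (fun v i => exists j, i <= j /\ j < size bags /\
        forall k, k < size bags -> (f v \in nth set0 bags k) = (i <= k <= j))).
have [r rP] : exists r : T -> nat, forall v, l v <= r v /\ r v < size bags /\
        forall k, k < size bags -> (f v \in nth set0 bags k) = (l v <= k <= r v).
  exact: (@fin_all_exists _ (fun=> nat) (fun v j => l v <= j /\ j < size bags /\
        forall k, k < size bags -> (f v \in nth set0 bags k) = (l v <= k <= j))).
have [v|u v uv|p] := wide l r; first by case: (rP v).
  have fuv : gadj G (f u) (f v) by rewrite /= /A /= !enum_rankK.
  have [k [kb [uk vk]]] := bagE _ _ fuv.
  move: uk vk; have [_ [_ ->]] // := rP u; have [_ [_ ->]] // := rP v.
  by move=> /andP[_ h1] /andP[h2 _]; apply: leq_trans h1.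
apply/negP; rewrite -leqNgt; set X := [set v | _].
(* A non-empty [X] shows that [p] is the index of a bag. *)
have [->|/set0Pn[x0]] := eqVneq X set0; first by rewrite cards0.
rewrite inE => /andP[_ px0].
have pb : p < size bags by case: (rP x0) => _ [rb _]; apply: leq_ltn_trans rb.
set B := nth set0 bags p; have BB : B \in bags by apply: mem_nth.
pose m := L apex; pose Y i := [set v in B | L v == i].
rewrite -(card_imset _ finj).
(* Every [f v] is adjacent to the apex, so only the layers [m.-1], [m] and [m.+1] occur; for [m = 0]
   the first two coincide. *)
apply: (@leq_trans #|Y m.-1 :|: Y m :|: Y m.+1|).
  apply: subset_leq_card; apply/subsetP=> w /imsetP[v vX ->].
  have vB : f v \in B by move: vX; rewrite inE; have [_ [_ ->]] := rP v.
  have av : gadj G apex (f v) by rewrite /= /A /= !enum_rankK.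
  have [h1 h2] := Llay _ _ av; rewrite -/m in h1 h2.
  rewrite !in_setU /Y !inE vB /=; lia.
rewrite (_ : 3 * c = c + c + c); last by lia.
apply: leq_trans (leq_card_setU _ _) _; apply: leq_add; last exact: Lw.
by apply: leq_trans (leq_card_setU _ _) _; apply: leq_add; apply: Lw.
Qed.

Theorem theorem4 (C : graph_class) :
  minor_closed C ->
  (bounded_lpw C <-> exists G : graph, apex_forest G /\ ~ C G).
Proof.
move=> mc; split=> [[c bc]|[H [aH nH]]].
  have [G [aG nG]] := wide_apex_forest c.
  by exists G; split=> // /bc.
exists (3 * gn H) => G CG; apply: apex_forest_minor_free_lpw aH _ => HG.
by apply: nH; apply: mc HG.
Qed.
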